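(* Let $X$ be a topological space. Then $B_1(X)$ with the $m_B$-topology is a topological ring.
   Context: A Baire one function on a topological space $X$ is a function $f:X\to\mathbb{R}$ that is the pointwise limit of a sequence of continuous real-valued functions on $X$. $B_1(X)$ is the commutative ring, under pointwise operations, of all Baire one functions on $X$. A positive unit of $B_1(X)$ is a unit $u$ of the ring $B_1(X)$ with $u(x)>0$ for all $x\in X$. The $m_B$-topology on $B_1(X)$ is the topology having as an open base the sets $\widetilde{M}(g,u)=\{f\in B_1(X): |f(x)-g(x)|<u(x)\text{ for every }x\in X\}$, where $g\in B_1(X)$ and $u$ is a positive unit of $B_1(X)$. *)

(* Defs.v *)
From HB Require Import structures.
From mathcomp Require Import all_boot all_order all_algebra.
From mathcomp Require Import all_classical all_reals all_analysis.

Set Implicit Arguments.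
Unset Strict Implicit.
Unset Printing Implicit Defensive.

Import Order.TTheory GRing.Theory Num.Theory.
Import numFieldNormedType.Exports.

Local Open Scope classical_set_scope.
Local Open Scope ring_scope.

HB.structure Definition PreTopologicalPzRing :=
  {A of Topological A & GRing.PzRing A}.

Definition is_topological_ring (A : PreTopologicalPzRing.type) : Prop :=
  [/\ continuous (fun p : A * A => p.1 + p.2),
      continuous (fun a : A => - a) &
      continuous (fun p : A * A => p.1 * p.2)].

(* [GRing.unit] is only available in rings with 1 != 0, whereas B1 X R is the
   zero ring when X is empty. *)
Definition is_unit (A : comPzRingType) (u : A) : Prop := exists v, u * v = 1.

Section baire_one.
Context {X : topologicalType} {R : realType}.
Implicit Types f g : X -> R.

Definition baire_one f : Prop :=
  exists F : nat -> X -> R,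
    (forall n, continuous (F n)) /\ (forall x, F n x @[n --> \oo] --> f x).

Definition baire_one_pred : {pred X -> R} := mem [set f | baire_one f].

Lemma baire_one_continuous f : continuous f -> baire_one f.
Proof. by move=> cf; exists (fun=> f); split=> // x; exact: cvg_cst. Qed.

Lemma baire_oneB f g : baire_one f -> baire_one g -> baire_one (f - g).
Proof.
move=> [F [cF Ff]] [G [cG Gg]]; exists (fun n => F n - G n); split.
  by move=> n x; apply: cvgB; [exact: cF|exact: cG].
by move=> x; apply: cvgB; [exact: Ff|exact: Gg].
Qed.

Lemma baire_oneM f g : baire_one f -> baire_one g -> baire_one (f * g).
Proof.
move=> [F [cF Ff]] [G [cG Gg]]; exists (fun n => F n * G n); split.
  by move=> n x; apply: cvgM; [exact: cF|exact: cG].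
by move=> x; apply: cvgM; [exact: Ff|exact: Gg].
Qed.

Lemma baire_one_norm f : baire_one f -> baire_one (fun x => `|f x|).
Proof.
move=> [F [cF Ff]]; exists (fun n x => `|F n x|); split.
  by move=> n x; apply: cvg_norm; exact: cF.
by move=> x; apply: cvg_norm; exact: Ff.
Qed.

Lemma baire_one_min f g :
  baire_one f -> baire_one g -> baire_one (fun x => Num.min (f x) (g x)).
Proof.
move=> bf bg; have b0 : baire_one (cst 0 : X -> R).
  by apply: baire_one_continuous => x; exact: cvg_cst.
have bh : baire_one (cst 2^-1 : X -> R).
  by apply: baire_one_continuous => x; exact: cvg_cst.
have -> : (fun x => Num.min (f x) (g x)) =
          (f - (cst 0 - g) - (fun x => `|(f - g) x|)) * cst 2^-1.
  apply/funext => x; rewrite minr_absE.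
  by rewrite -[RHS]/((f x - (0 - g x) - `|f x - g x|) / 2) sub0r opprK.
apply: baire_oneM bh; apply: baire_oneB; last exact/baire_one_norm/baire_oneB.
by apply: baire_oneB bf _; exact: baire_oneB.
Qed.

Lemma baire_oneV f :
  baire_one f -> (forall x, f x != 0) -> baire_one (fun x => (f x)^-1).
Proof.
move=> [F [cF Ff]] f0.
exists (fun n x => F n x / (F n x * F n x + n.+1%:R^-1)); split.
  move=> n x; apply: cvgM; first exact: cF.
  apply: cvgV.
    by rewrite gt_eqF// ltr_wpDl -?expr2 ?sqr_ge0// invr_gt0 ltr0n.
  by apply: cvgD; [apply: cvgM; exact: cF|exact: cvg_cst].
move=> x; rewrite (_ : (f x)^-1 = f x / (f x * f x + 0)); last first.
  by rewrite addr0 invfM mulrA divff// mul1r.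
apply: cvgM; first exact: Ff.
apply: cvgV; first by rewrite addr0 mulf_neq0.
by apply: cvgD; [apply: cvgM; exact: Ff|exact: cvg_harmonic].
Qed.

Lemma baire_one_subring : subring_closed baire_one_pred.
Proof.
split=> [|f g|f g]; rewrite ?inE /=.
- by apply: baire_one_continuous => x; exact: cvg_cst.
- exact: baire_oneB.
- exact: baire_oneM.
Qed.

End baire_one.

Record B1 (X : topologicalType) (R : realType) := MkB1 {
  B1_fun :> X -> R;
  _ : B1_fun \in baire_one_pred }.

Section B1_ring.
Context {X : topologicalType} {R : realType}.

HB.instance Definition _ := [isSub for @B1_fun X R].
HB.instance Definition _ := [Choice of B1 X R by <:].
HB.instance Definition _ := GRing.SubChoice_isSubComPzRing.Build
  (X -> R) baire_one_pred (B1 X R) baire_one_subring.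

End B1_ring.

Section mB_topology.
Context {X : topologicalType} {R : realType}.
Implicit Types f g u v : B1 X R.

Definition positive_unit u : Prop := is_unit u /\ forall x, 0 < u x.

Definition mB_ball g u : set (B1 X R) :=
  [set f | forall x, `|f x - g x| < u x].

HB.instance Definition _ := isPointed.Build (B1 X R) 0.

Lemma B1_baire_one f : baire_one f.
Proof. by case: f => f /= /set_mem. Qed.

Lemma positive_unitP (w : X -> R) : baire_one w -> (forall x, 0 < w x) ->
  exists2 u : B1 X R, positive_unit u & forall x, u x = w x.
Proof.
move=> bw w0; have bw' : baire_one (fun x => (w x)^-1).
  by apply: baire_oneV => // x; rewrite gt_eqF.
exists (MkB1 (mem_set bw)) => //; split=> //.
exists (MkB1 (mem_set bw')); apply/val_inj/funext => x /=.
by rewrite -[LHS]/(w x * (w x)^-1) divff// gt_eqF.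
Qed.

Let base (i : B1 X R * B1 X R) : set (B1 X R) := mB_ball i.1 i.2.

Let D : set (B1 X R * B1 X R) := [set i | positive_unit i.2].

Let base_cover : \bigcup_(i in D) base i = setT.
Proof.
apply/seteqP; split=> // f _; exists (f, 1); last first.
  by move=> x; rewrite /= subrr normr0 -[ltRHS]/(1 : R) ltr01.
by split=> [|x]; [exists 1; rewrite mulr1|exact: ltr01].
Qed.

Let base_join i j t : D i -> D j -> base i t -> base j t ->
  exists k, [/\ D k, base k t & base k `<=` base i `&` base j].
Proof.
case: i j => [g u] [h v] _ _; rewrite /base /= => tgu thv.
pose d (a b : B1 X R) x : R := b x - `|t x - a x|.
have bd a b : baire_one (d a b).
  apply: baire_oneB (B1_baire_one b) _; apply: baire_one_norm.
  exact: baire_oneB (B1_baire_one t) (B1_baire_one a).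
have [||w uw wE] := @positive_unitP (fun x => Num.min (d g u x) (d h v x)).
- exact: baire_one_min.
- by move=> x; rewrite lt_min !subr_gt0 tgu thv.
exists (t, w); split=> //= [x|f ft].
  by rewrite subrr normr0; case: uw => _; exact.
have tri a b (le_wd : forall x, w x <= d a b x) : mB_ball a b f.
  move=> x; rewrite (_ : f x - a x = (f x - t x) + (t x - a x)); last first.
    by rewrite addrA subrK.
  apply: le_lt_trans (ler_normD _ _) _; rewrite -ltrBrDr.
  exact: lt_le_trans (ft x) (le_wd x).
by split; apply: tri => x; rewrite wE ge_min lexx ?orbT.
Qed.

HB.instance Definition _ :=
  isBaseTopological.Build (B1 X R) base_cover base_join.

Lemma open_mBP (A : set (B1 X R)) : open A <->
  exists2 C : set (B1 X R * B1 X R), C `<=` [set i | positive_unit i.2] &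
    \bigcup_(i in C) mB_ball i.1 i.2 = A.
Proof. by []. Qed.

End mB_topology.

(* Main.v *)
(** A basic open set [mB_ball g u] containing [t] contains the ball about [t]
    with Baire one radius [u - |t - g|], so continuity can be tested on balls
    centred at the point.  For the product at [(a, b)] with tolerance [u], the
    Baire one radius [v = u / (u + (1 + |a| + |b|))] works: [v < 1], so
    [|fg - ab| <= |f - a| |g - b| + |f - a| |b| + |a| |g - b|
               < v (1 + |a| + |b|) < u]. *)

Require Import Defs.
From mathcomp Require Import all_boot all_order all_algebra.
From mathcomp Require Import all_classical all_reals all_analysis.
From mathcomp Require Import ring lra.

Set Implicit Arguments.
Unset Strict Implicit.
Unset Printing Implicit Defensive.

Import Order.TTheory GRing.Theory Num.Theory.
Import numFieldNormedType.Exports.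

Local Open Scope classical_set_scope.
Local Open Scope ring_scope.

Section mB_topology_theory.
Context {X : topologicalType} {R : realType}.
Implicit Types a b f g t u : B1 X R.

Lemma baire_oneD (f g : X -> R) :
  baire_one f -> baire_one g -> baire_one (f + g).
Proof.
move=> [F [cF Ff]] [G [cG Gg]]; exists (fun n => F n + G n); split.
  by move=> n x; apply: cvgD; [exact: cF|exact: cG].
by move=> x; apply: cvgD; [exact: Ff|exact: Gg].
Qed.

Lemma open_mB_ball t u : positive_unit u -> open (mB_ball t u).
Proof.
move=> pu; apply/open_mBP; exists [set (t, u)]; first by move=> _ ->.
by rewrite bigcup_set1.
Qed.

Lemma nbhs_mB_ball t u : positive_unit u -> nbhs t (mB_ball t u).
Proof.
move=> pu; apply: open_nbhs_nbhs; split; first exact: open_mB_ball.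
by move=> x; rewrite subrr normr0; case: pu => _; exact.
Qed.

(** With [nbhs_mB_ball], this makes the balls centred at [t] a neighbourhood base at [t], although
    the basic open sets are balls about arbitrary centres. *)
Lemma nbhs_mB_ballP t (A : set (B1 X R)) :
  nbhs t A -> exists2 u, positive_unit u & mB_ball t u `<=` A.
Proof.
rewrite nbhsE => -[B [/open_mBP[C Cpos <-] [[g u] /= Cgu tgu]] BA].
(* The slack left at [t] in the ball about [g]; it is positive everywhere because [t] lies in that
   ball. *)
have bw : baire_one ((u : X -> R) - (fun x => `|t x - g x|)).
  apply: baire_oneB (B1_baire_one u) _; apply: baire_one_norm.
  exact: baire_oneB (B1_baire_one t) (B1_baire_one g).
have [|w pw wE] := positive_unitP bw.
  by move=> x; rewrite -[ltRHS]/(u x - `|t x - g x|) subr_gt0.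
exists w => // f ft; apply: BA; exists (g, u) => //= x.
rewrite -(subrKA (t x)); apply: le_lt_trans (ler_normD _ _) _.
by rewrite -ltrBrDr; have := ft x; rewrite wE.
Qed.

Lemma mB_add_continuous : continuous (fun p : B1 X R * B1 X R => p.1 + p.2).
Proof.
move=> [a b] A /= /nbhs_mB_ballP[u [_ u0] uA].
have b2 : baire_one (cst 2^-1 : X -> R).
  by apply: baire_one_continuous => x; exact: cvg_cst.
(* Each summand receives half of the tolerance, [v = u / 2]. *)
have [|v pv vE] := positive_unitP (baire_oneM (B1_baire_one u) b2).
  by move=> x; apply: mulr_gt0; [exact: u0|rewrite invr_gt0 ltr0n].
exists (mB_ball a v, mB_ball b v); first by split; exact: nbhs_mB_ball.
move=> [f g] [/= fa gb]; apply: uA => x.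
rewrite -[(f + g) x]/(f x + g x) -[(a + b) x]/(a x + b x) opprD addrACA.
apply: le_lt_trans (ler_normD _ _) _.
have vx : v x = u x / 2 by rewrite vE.
by move: (fa x) (gb x); rewrite vx; lra.
Qed.

(** Negation preserves pointwise distances, so the same radius [u] serves. *)
Lemma mB_opp_continuous : continuous (fun f : B1 X R => - f).
Proof.
move=> a A /= /nbhs_mB_ballP[u pu uA].
apply: filterS (nbhs_mB_ball a pu) => f fa; apply: uA => x.
by rewrite -[(- f) x]/(- f x) -[(- a) x]/(- a x) -opprD normrN.
Qed.

Lemma mB_mul_continuous : continuous (fun p : B1 X R * B1 X R => p.1 * p.2).
Proof.
move=> [a b] A /= /nbhs_mB_ballP[u [_ u0] uA].
(* The bound [1 <= k] keeps [u + k] positive, so that its inverse is Baire one, and also forces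
   [v = u / (u + k) < 1]. *)
pose k x := 1 + `|a x| + `|b x|.
have k1 x : 1 <= k x by rewrite /k -addrA lerDl addr_ge0.
have uk0 x : 0 < u x + k x.
  by rewrite addr_gt0// (lt_le_trans ltr01 (k1 x)).
have bk : baire_one k.
  apply: baire_oneD; last exact/baire_one_norm/B1_baire_one.
  apply: baire_oneD; last exact/baire_one_norm/B1_baire_one.
  by apply: baire_one_continuous => x; exact: cvg_cst.
have bv : baire_one ((u : X -> R) * (fun x => (u x + k x)^-1)).
  apply: baire_oneM (B1_baire_one u) _; apply: baire_oneV.
    exact: baire_oneD (B1_baire_one u) bk.
  by move=> x; rewrite gt_eqF.
have [|v pv vE] := positive_unitP bv.
  by move=> x; apply: mulr_gt0; rewrite ?invr_gt0.
exists (mB_ball a v, mB_ball b v); first by split; exact: nbhs_mB_ball.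
move=> [f g] [/= fa gb]; apply: uA => x.
rewrite -[(f * g) x]/(f x * g x) -[(a * b) x]/(a x * b x).
have -> : f x * g x - a x * b x =
    (f x - a x) * (g x - b x) + (f x - a x) * b x + a x * (g x - b x) by ring.
have v0 : 0 < v x by case: pv => _; exact.
have vx : v x * (u x + k x) = u x.
  by rewrite vE -[X in X * _]/(u x / (u x + k x)) divfK// gt_eqF.
have v1 : v x < 1.
  rewrite -(ltr_pM2r (uk0 x)) vx mul1r ltrDl.
  exact: lt_le_trans ltr01 (k1 x).
have le_b : `|f x - a x| * `|b x| <= v x * `|b x|.
  by rewrite ler_wpM2r// ltW.
have le_a : `|a x| * `|g x - b x| <= v x * `|a x|.
  by rewrite mulrC ler_wpM2r// ltW.
(* The quadratic term is below [v * v], and [v < 1] absorbs it into the summand [1] of [k]. *)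
have lt_v : `|f x - a x| * `|g x - b x| < v x.
  apply: le_lt_trans (_ : v x * v x < v x); last by rewrite gtr_pMl.
  by apply: ler_pM => //; apply: ltW.
apply: le_lt_trans (ler_normD _ _) _.
apply: le_lt_trans (lerD (ler_normD _ _) (lexx _)) _.
(* The three bounds add up to less than [v * k], which by [vx] equals [u - v * u], hence is below
   [u]. *)
have vu0 : 0 < v x * u x by rewrite mulr_gt0.
by move: vx; rewrite !normrM /k !mulrDr; lra.
Qed.

End mB_topology_theory.

Theorem theorem2p11 (R : realType) (X : topologicalType) :
  is_topological_ring (B1 X R).
Proof.
split.
- exact: mB_add_continuous.
- exact: mB_opp_continuous.
- exact: mB_mul_continuous.
Qed.
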